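(* For any graph $G$ and any integer $r \geq 1$, $$\mathbb{E}_\pi[\mathrm{cost}_{r\text{-PIVOT}}(G, \pi)] \leq \mathbb{E}_\pi[\mathrm{cost}_{\text{PIVOT}}(G, \pi)] + \frac{8}{2r-1} \cdot \mathrm{OPT}(G),$$ where $\pi$ is a uniformly random permutation of the vertex set.
   Context: Correlation clustering: the input is a simple undirected graph $G=(V,E)$ on $n$ vertices (pairs in $E$ are ''similar'', non-adjacent pairs are ''dissimilar''). A clustering is a partition of $V$ into arbitrarily many clusters; its cost is the number of edges whose endpoints lie in different clusters plus the number of non-adjacent pairs whose endpoints lie in the same cluster. $\mathrm{OPT}(G)$ is the minimum cost over all clusterings. $N(v)$ denotes the neighborhood of $v$. Algorithm PIVOT on permutation $\pi$ of $V$: while vertices remain, let $v$ be the remaining vertex of lowest rank in $\pi$, mark it a pivot, form the cluster consisting of $v$ and its remaining neighbors, and remove this cluster. $\mathrm{cost}_{\text{PIVOT}}(G,\pi)$ is the cost of its output. Algorithm $r$-PIVOT on permutation $\pi$: initially every vertex is unsettled. For $r$ rounds: every unsettled $v$ with $\pi(v) < \pi(u)$ for all unsettled $u \in N(v)$ is marked a pivot (simultaneously); then all pivots and all vertices adjacent to pivots are marked settled. Afterwards, every pivot starts a cluster containing itself, and each non-pivot vertex $u$: if $N(u)$ contains no pivot, or if there is an unsettled $w \in N(u)$ whose rank is smaller than the ranks of all pivots in $N(u)$, then $u$ forms a singleton cluster; otherwise $u$ joins the cluster of the minimum-rank pivot in $N(u)$. $\mathrm{cost}_{r\text{-PIVOT}}(G,\pi)$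 is the cost of its output. *)

(* Defs.v *)
From mathcomp Require Import all_boot all_order all_fingroup all_algebra.

Set Implicit Arguments.
Unset Strict Implicit.
Unset Printing Implicit Defensive.

Section CorrelationClustering.

Variable V : finType.

Definition nbhd (e : rel V) (v : V) : {set V} := [set u | e v u].

(* The blocks of P are the clusters.  Pairs are unordered: an edge {x, y} is
   the two-element set [set x; y], so it is counted once. *)
Definition cost (e : rel V) (P : {set {set V}}) : nat :=
  #|[set [set x; y] | x in V, y in V & e x y && (pblock P x != pblock P y)]|
  + #|[set [set x; y] | x in V, y in V
        & [&& x != y, ~~ e x y & pblock P x == pblock P y]]|.

Definition singletons : {set {set V}} := [set [set x] | x : V].

Lemma singletons_partition : partition singletons [set: V].
Proof.
apply/and3P; split.
- by apply/eqP/setP => x; rewrite inE; apply/bigcupP; exists [set x];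
    rewrite ?set11 ?imset_f.
- apply/trivIsetP => _ _ /imsetP[x _ ->] /imsetP[y _ ->] nxy.
  by rewrite disjoints1 inE; apply: contra nxy => /eqP->.
- by apply/imsetP => -[x _ /setP/(_ x)]; rewrite !inE eqxx.
Qed.

Definition OPT (e : rel V) : nat :=
  cost e [arg min_(P < singletons | partition P [set: V]) cost e P].

Lemma OPT_le e P : partition P [set: V] -> OPT e <= cost e P.
Proof.
by rewrite /OPT; case: arg_minnP => [|Q _]; [exact: singletons_partition | exact].
Qed.

Lemma OPT_attained e : exists2 P, partition P [set: V] & cost e P = OPT e.
Proof.
by rewrite /OPT; case: arg_minnP => [|Q]; [exact: singletons_partition | exists Q].
Qed.

(* As p ranges over {perm V}, rank p ranges over all bijections from V to
   {0, ..., #|V| - 1}, each obtained exactly once. *)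
Definition rank (p : {perm V}) (v : V) : nat := enum_rank (p v).

Lemma rank_inj p : injective (rank p).
Proof. by move=> x y /ord_inj/enum_rank_inj/perm_inj. Qed.

Definition lowest (p : {perm V}) (A : {set V}) : option V :=
  [pick v in A | [forall u in A, rank p v <= rank p u]].

(* A state is (remaining vertices, clusters formed so far). *)
Definition pivot_step (e : rel V) (p : {perm V})
    (s : {set V} * {set {set V}}) : {set V} * {set {set V}} :=
  if lowest p s.1 is Some v then
    let C := s.1 :&: (v |: nbhd e v) in (s.1 :\: C, C |: s.2)
  else s.

(* Each step removes at least one vertex while some remain, and the state is
   unchanged afterwards, so #|V| steps run the loop to completion. *)
Definition pivot (e : rel V) (p : {perm V}) : {set {set V}} :=
  (iter #|V| (pivot_step e p) ([set: V], set0)).2.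

Lemma lowest_Some p (A : {set V}) v : lowest p A = Some v ->
  v \in A /\ {in A, forall u, rank p v <= rank p u}.
Proof.
rewrite /lowest; case: pickP => // x /andP[xA /forall_inP xP] [<-].
by split.
Qed.

Lemma lowest_None p (A : {set V}) : lowest p A = None -> A = set0.
Proof.
rewrite /lowest; case: pickP => // noA _.
apply/eqP; apply: contraT => /set0Pn[x xA].
case: (arg_minnP (P := mem A) (rank p) xA) => v vA vP.
by rewrite -(noA v); apply/andP; split=> //; apply/forall_inP.
Qed.

Lemma pivot_partition e p : partition (pivot e p) [set: V].
Proof.
pose inv k (s : {set V} * {set {set V}}) :=
  partition s.2 (~: s.1) /\ #|s.1| <= #|V| - k.
have step k s : inv k s -> inv k.+1 (pivot_step e p s).
  case: s => R P [/= PR cR]; rewrite /pivot_step /=.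
  case low: (lowest p R) => [v|]; last first.
    by split=> //=; rewrite (lowest_None low) cards0.
  have [vR _] := lowest_Some low.
  set C := R :&: _; have vC : v \in C by rewrite !inE vR eqxx.
  have CR : C \subset R by apply: subsetIl.
  split=> /=.
    have -> : ~: (R :\: C) = C :|: ~: R by rewrite setCD setUC.
    apply: partitionU1 => //; first by apply/set0Pn; exists v.
    by rewrite disjoints_subset setCK.
  rewrite subnS -ltnS; case: (posnP (#|V| - k)) => [k0|/prednK->].
    by move: cR; rewrite k0 leqn0 cards_eq0 => /eqP R0; rewrite R0 inE in vR.
  apply: leq_trans cR; apply: proper_card; apply/properP; split.
    exact: subsetDl.
  by exists v; rewrite // inE vC.
have all_inv k : inv k (iter k (pivot_step e p) ([set: V], set0)).
  elim: k => [|k IHk]; last exact: step.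
  by split=> /=; rewrite ?setCT ?partition_set0 ?subn0 ?max_card.
have [] := all_inv #|V|; rewrite subnn leqn0 cards_eq0 => + /eqP R0.
by rewrite R0 setC0.
Qed.

(* A state is (pivots, unsettled vertices). *)
Definition rpivot_round (e : rel V) (p : {perm V})
    (s : {set V} * {set V}) : {set V} * {set V} :=
  let P := s.1 :|:
    [set v in s.2 | [forall u in s.2 :&: nbhd e v, rank p v < rank p u]] in
  (P, s.2 :\: (P :|: \bigcup_(v in P) nbhd e v)).

Definition rpivot_state (e : rel V) (r : nat) (p : {perm V}) :
    {set V} * {set V} :=
  iter r (rpivot_round e p) (set0, [set: V]).

(* The vertex naming the cluster of u: the pivot whose cluster contains u, or
   u itself if u is a singleton cluster. *)
Definition rpivot_leader (e : rel V) (r : nat) (p : {perm V}) (u : V) : V :=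
  let: (P, U) := rpivot_state e r p in
  if u \in P then u
  else if [exists w in U :&: nbhd e u,
             [forall v in P :&: nbhd e u, rank p w < rank p v]] then u
  else if lowest p (P :&: nbhd e u) is Some v then v
  else u.

(* No other vertex has a non-pivot as its leader, so every non-pivot that is
   its own leader is indeed alone in its block. *)
Definition rpivot (e : rel V) (r : nat) (p : {perm V}) : {set {set V}} :=
  preim_partition (rpivot_leader e r p) [set: V].

Definition expect_perm (R : realFieldType) (f : {perm V} -> nat) : R :=
  ((\sum_(p : {perm V}) (f p)%:R) / #|{: {perm V}}|%:R)%R.

End CorrelationClustering.

(* Main.v *)
Require Import Defs.
From mathcomp Require Import all_boot all_order all_fingroup all_algebra.
From mathcomp Require Import ring lra.

(* Let elm x be the pivot whose PIVOT cluster contains x.  r-PIVOT refines PIVOT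
   by isolating vertices, so its extra cost is at most the number of edges split
   inside PIVOT clusters.  If a pivot w0 is unsettled after r rounds, then it has
   an earlier neighbour w1 unsettled after r - 1 rounds, and w2 = elm w1 is again
   an unsettled pivot; iterating yields r bad triangles (w0, w1, w2),
   (w2, w3, w4), ... along a path of queries of decreasing rank, and an optimal
   clustering errs on a pair of each of them.

   To count how often a given pair is met by such paths, reveal the permutation
   from the lowest rank up.  Let weight y be the number of query paths from y that
   meet the pair, counted among the arrived vertices, and deg y the number of
   neighbours of y without an arrived pivot in their closed neighbourhood.  The
   potential sum_y weight y * (1 + deg y / 2), plus a term theta for the pair
   itself, does not increase in expectation once an arriving vertex cashes in its
   weight and every edge of an arriving cluster cashes in a third of the weights
   of its two ends and of the pivot.  Since theta starts at 1/2 for each of the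
   2 OPT ordered mistaken pairs, the expected total reward is at most OPT, while a
   split edge earns at least r / 3.  So r-PIVOT exceeds PIVOT by at most
   3 OPT / r <= 8 OPT / (2 r - 1). *)

Set Implicit Arguments.
Unset Strict Implicit.
Unset Printing Implicit Defensive.

Import Order.TTheory GRing.Theory Num.Theory.

(** * The arrival process and the exact evolution of its potential *)

Section Process.

Local Open Scope ring_scope.

Variables (R : realFieldType) (V : finType) (e : rel V).
Hypotheses (e_sym : symmetric e) (e_irr : irreflexive e).
(** [g v k y] is what y collects by querying v when k is the killer of v. Keeping it abstract
    separates the transport of weights from the marking of mistaken pairs. *)
Variable g : V -> option V -> V -> R.

(* [alive]: the vertices that have not arrived and have no arrived pivot
   neighbour, so that a vertex is a pivot iff it is alive when it arrives.
   [weight y]: the gains collected so far by the query paths starting at y, where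
   y queries v when v arrives while y is alive.  [killer y]: the pivot whose
   arrival ended the life of y. *)
Record state := State
  {alive : {set V}; weight : V -> R; killer : V -> option V}.

Definition arrive (st : state) (v : V) : state := State
  (if v \in alive st then alive st :\: (v |: nbhd e v) else alive st)
  (fun y => weight st y +
     (y \in alive st)%:R * (e v y)%:R * (weight st v + g v (killer st v) y))
  (fun y => if [&& v \in alive st, y \in alive st & e v y] then Some v
            else killer st y).

(* The ordered sum visits every edge of the cluster of a pivot v twice, so each
   edge {x, y} is worth a third of the three weights; this is the share for
   which [potential_step] is an exact martingale identity. *)
Definition reward (st : state) (v : V) : R :=
  weight st v + 6^-1 * \sum_x \sum_y
    ([&& v \in alive st, x \in alive st & y \in alive st]
     && [&& e v x, e v y & e x y])%:R *
    (weight st v + weight st x + weight st y).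

Definition deg (H : {set V}) (y : V) : R := \sum_x (x \in H)%:R * (e y x)%:R.

Definition codeg (H : {set V}) (v y : V) : R :=
  \sum_x (x \in H)%:R * (e v x)%:R * (e y x)%:R.

Lemma boolR_idem (b : bool) : b%:R * b%:R = b%:R :> R.
Proof. by case: b; rewrite ?mulr1 ?mulr0. Qed.

Lemma alive_arrive st v x : (x \in alive (arrive st v))%:R =
  (x \in alive st)%:R * (1 - (v \in alive st)%:R * ((x == v)%:R + (e v x)%:R)) :> R.
Proof.
rewrite /arrive /=; case: (boolP (v \in alive st)) => vH; last by rewrite mul0r subr0 mulr1.
rewrite !inE; have [->|_] := eqVneq x v.
  by rewrite e_irr vH /= mul1r; ring.
by case: (e v x); case: (x \in _) => /=; ring.
Qed.

Lemma deg_arrive st v y : deg (alive (arrive st v)) y =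
  deg (alive st) y
  - (v \in alive st)%:R * ((e y v)%:R + codeg (alive st) v y).
Proof.
rewrite /deg /codeg; under eq_bigr => x _ do rewrite alive_arrive.
set H := alive st.
have -> : (v \in H)%:R * ((e y v)%:R + \sum_x (x \in H)%:R * (e v x)%:R * (e y x)%:R)
  = \sum_x (v \in H)%:R * ((x == v)%:R * (x \in H)%:R * (e y x)%:R
      + (x \in H)%:R * (e v x)%:R * (e y x)%:R) :> R.
  rewrite -big_distrr big_split /= !mulrDr; congr (_ + _).
  rewrite (bigD1 v) //= big1 ?addr0 => [|x /negbTE->]; last by rewrite !mul0r.
  by rewrite eqxx mul1r mulrA boolR_idem.
rewrite -sumrB; apply: eq_bigr => x _; ring.
Qed.

(** Both sides count the walks y - x - v with x and v in H. *)
Lemma codeg_sum (H : {set V}) y : \sum_v (v \in H)%:R * codeg H v y =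
  \sum_x (x \in H)%:R * (e y x)%:R * deg H x.
Proof.
under eq_bigr => v _ do rewrite big_distrr.
rewrite exchange_big; apply: eq_bigr => x _ /=.
by rewrite big_distrr; apply: eq_bigr => v _ /=; rewrite (e_sym v x); ring.
Qed.

Lemma codeg_diag (H : {set V}) y : codeg H y y = deg H y.
Proof. by apply: eq_bigr => x _; rewrite -mulrA boolR_idem. Qed.

Definition triangles (H : {set V}) (v : V) : R :=
  \sum_x (x \in H)%:R * (e v x)%:R * codeg H v x.

(** The triangle indicator is symmetric in its three vertices, so the three weights contribute
    equally and the factor 1/6 becomes 1/2. *)
Lemma sum_reward st (S : {set V}) : alive st \subset S ->
  \sum_(v in S) reward st v =
  \sum_(v in S) weight st v * (1 + (v \in alive st)%:R * triangles (alive st) v / 2).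
Proof.
case: st => H W K /= HS.
rewrite /reward big_split /= -big_distrr /=.
pose X v x y : R := ([&& v \in H, x \in H & y \in H] && [&& e v x, e v y & e x y])%:R.
have X1 v x y : X v x y = X x v y.
  rewrite /X (e_sym x v); congr (nat_of_bool _)%:R.
  by case: (v \in H); case: (x \in H); case: (e v x); case: (e v y); case: (e x y).
have X2 v x y : X v x y = X v y x.
  rewrite /X (e_sym x y); congr (nat_of_bool _)%:R.
  by case: (y \in H); case: (x \in H); case: (e v x); case: (e v y); case: (e y x).
have Xt v : \sum_x \sum_y X v x y = (v \in H)%:R * triangles H v.
  rewrite big_distrr; apply: eq_bigr => x _ /=; rewrite mulrA big_distrr.
  by apply: eq_bigr => y _; rewrite /X -!mulnb !natrM /=; ring.
have toS (F : V -> R) : (forall v, v \notin S -> F v = 0) ->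
    \sum_(v in S) F v = \sum_v F v.
  by move=> F0; rewrite [RHS](bigID (mem S)) /= [X in _ + X]big1 ?addr0.
have XS v x y : v \notin S -> X v x y = 0.
  move=> vS; rewrite /X; case: (boolP (v \in H)) => // /(subsetP HS).
  by rewrite (negbTE vS).
have -> : \sum_(v in S) \sum_x \sum_y X v x y * (W v + W x + W y) =
    3 * \sum_(v in S) W v * ((v \in H)%:R * triangles H v).
  rewrite !toS; first last.
  - by move=> v vS; rewrite big1 // => x _; rewrite big1 // => y _; rewrite XS // mul0r.
  - move=> v vS; case: (boolP (v \in H)) => [/(subsetP HS)|_].
      by rewrite (negbTE vS).
    by rewrite mul0r mulr0.
  transitivity (\sum_v \sum_x \sum_y X v x y * W v +
    \sum_v \sum_x \sum_y X v x y * W x + \sum_v \sum_x \sum_y X v x y * W y).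
    rewrite -!big_split; apply: eq_bigr => v _ /=; rewrite -!big_split.
    by apply: eq_bigr => x _ /=; rewrite -!big_split; apply: eq_bigr => y _ /=; ring.
  have Ev : \sum_v \sum_x \sum_y X v x y * W v = \sum_v W v * ((v \in H)%:R * triangles H v).
    apply: eq_bigr => v _; rewrite -Xt [RHS]big_distrr; apply: eq_bigr => x _ /=.
    by rewrite big_distrr; apply: eq_bigr => y _ /=; rewrite mulrC.
  have Ex : \sum_v \sum_x \sum_y X v x y * W x = \sum_v \sum_x \sum_y X v x y * W v.
    rewrite exchange_big; apply: eq_bigr => v _; apply: eq_bigr => x _.
    by apply: eq_bigr => y _; rewrite X1.
  have Ey : \sum_v \sum_x \sum_y X v x y * W y = \sum_v \sum_x \sum_y X v x y * W x.
    apply: eq_bigr => v _; rewrite exchange_big; apply: eq_bigr => x _.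
    by apply: eq_bigr => y _; rewrite X2.
  by rewrite Ey Ex Ev; ring.
rewrite mulrA big_distrr -big_split; apply: eq_bigr => v _ /=; lra.
Qed.

(** Compare the coefficients of [weight st y]: what y keeps while others arrive, what it passes on
    when it arrives itself, and its reward. The walk counts [D y] and the triangle counts cancel,
    leaving #|S| * (1 + deg / 2); the new gains form the last sum. *)
Lemma potential_step st (S : {set V}) : alive st \subset S ->
  \sum_(v in S) (reward st v + \sum_(y in S :\ v)
     weight (arrive st v) y * (1 + deg (alive (arrive st v)) y / 2)) =
  #|S|%:R * \sum_(y in S) weight st y * (1 + deg (alive st) y / 2) +
  \sum_(v in S) \sum_y (y \in alive st)%:R * (e v y)%:R *
     g v (killer st v) y * (1 + deg (alive (arrive st v)) y / 2).
Proof.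
move=> HS; rewrite big_split /= sum_reward //.
set H := alive st in HS *; set W := weight st.
set G := (X in _ = _ + X).
pose D y := \sum_x (x \in H)%:R * (e y x)%:R * deg H x.
have sub v : \sum_(y in S :\ v)
    weight (arrive st v) y * (1 + deg (alive (arrive st v)) y / 2)
  = \sum_(y in S :\ v) W y * (1 + deg (alive (arrive st v)) y / 2)
  + W v * (\sum_y (y \in H)%:R * (e v y)%:R * (1 + deg (alive (arrive st v)) y / 2))
  + \sum_y (y \in alive st)%:R * (e v y)%:R *
     g v (killer st v) y * (1 + deg (alive (arrive st v)) y / 2).
  rewrite big_distrr -addrA -big_split /=.
  rewrite [X in _ = _ + X](bigID (mem (S :\ v))) /= [X in _ = _ + (_ + X)]big1.
    by rewrite addr0 -big_split; apply: eq_bigr => y _ /=; rewrite -/H -/W; ring.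
  move=> y; rewrite !inE negb_and negbK => /orP[/eqP->|yS].
    by rewrite e_irr !(mulr0, mul0r) addr0.
  have /negbTE-> : y \notin alive st by apply: contra yS; apply: subsetP.
  by rewrite !(mulr0, mul0r) addr0.
under [X in _ + X = _]eq_bigr => v _ do rewrite sub.
rewrite !big_split /= addrA; congr (_ + _).
(* W y stays in place at each of the #|S| - 1 other arrivals, while the degree of y drops. The
   subtracted term is the drop for v = y, which does not occur here. *)
have -> : \sum_(v in S) \sum_(y in S :\ v)
      W y * (1 + deg (alive (arrive st v)) y / 2) =
    \sum_(y in S) W y * ((#|S|%:R - 1) * (1 + deg H y / 2)
      - (deg H y + D y - (y \in H)%:R * deg H y) / 2).
  rewrite (exchange_big_dep (mem S)) /=; last by move=> v y _ /setD1P[].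
  apply: eq_bigr => y yS; rewrite -big_distrr /=; congr (_ * _).
  under eq_bigl => v do rewrite !inE yS andbT eq_sym.
  under eq_bigr => v _ do rewrite deg_arrive -/H.
  transitivity (\sum_(v in S :\ y) (1 + deg H y / 2) - 
      (\sum_(v in S :\ y) (v \in H)%:R * ((e y v)%:R + codeg H v y)) / 2).
    rewrite [X in _ - X]big_distrl -sumrB /=.
    apply: eq_big => [v|v _]; first by rewrite !inE andbC.
    by ring.
  congr (_ - _ / _).
    have -> : #|S|%:R - 1 = #|S :\ y|%:R :> R.
      by rewrite (cardsD1 y S) yS natrD addrC addKr.
    by rewrite sumr_const mulr_natl.
  have -> : deg H y + D y = \sum_(v in S) (v \in H)%:R * ((e y v)%:R + codeg H v y).
    rewrite /D -codeg_sum -big_split [LHS](bigID (mem S)) /= [X in _ + X]big1 ?addr0.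
      by apply: eq_bigr => v _; ring.
    move=> v vS; have /negbTE-> : v \notin H by apply: contra vS; apply: subsetP.
    by rewrite !mul0r addr0.
  by rewrite (big_setD1 y yS) /= e_irr codeg_diag add0r [X in _ = X - _]addrC addrK.
rewrite -!big_split big_distrr /=; apply: eq_bigr => y yS.
(* The arriving y hands its weight to every alive neighbour, valued at the degree that this
   neighbour has after the arrival. *)
have -> : \sum_x (x \in H)%:R * (e y x)%:R * (1 + deg (alive (arrive st y)) x / 2) =
  deg H y + D y / 2 - (y \in H)%:R * (deg H y + triangles H y) / 2.
  rewrite /triangles [deg H y]/deg /D.
  rewrite -big_split [X in _ - X / _]big_distrr [X in _ - X]big_distrl /=.
  rewrite [X in _ + X - _]big_distrl -!big_split /= -sumrB.
  apply: eq_bigr => x _; rewrite deg_arrive -/H (e_sym x y).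
  by case: (e y x) => /=; lra.
lra.
Qed.

End Process.

#[local] Arguments arrive : simpl never.

(** * The share of the potential reserved for one mistaken pair *)

Section Theta.

Local Open Scope ring_scope.

Variables (R : realFieldType) (V : finType) (e : rel V).
Hypotheses (e_sym : symmetric e) (e_irr : irreflexive e).

(* When v arrives and is queried by y = a: an edge ab is met if v = b, and a
   non-edge ab is met, through the bad triangle a - v - b, if b settled v. *)
Definition mark (a b v : V) (k : option V) (y : V) : R :=
  ((y == a) && (if e a b then v == b else k == Some b))%:R.

(* Bounds the future contribution of the marks of (a, b); it starts at 1/2. *)
Definition theta (a b : V) (S : {set V}) (st : state R V) : R :=
  (a \in alive st)%:R / 2 *
  if e a b then (b \in S)%:R
  else (b \in alive st)%:R + \sum_(x in S) ((e a x) && (killer st x == Some b))%:R.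

Lemma theta_ge0 a b S st : 0 <= theta a b S st.
Proof.
rewrite /theta; apply: mulr_ge0; first by rewrite divr_ge0.
by case: (e a b) => //; apply: addr_ge0 => //; apply: sumr_ge0.
Qed.

Lemma sum_indic (S : {set V}) (F : V -> R) a : a \in S ->
  \sum_(v in S) (a == v)%:R * F v = F a.
Proof.
move=> aS; rewrite (big_setD1 a aS) /= eqxx mul1r big1 ?addr0 // => v.
by rewrite !inE eq_sym => /andP[/negbTE-> _]; rewrite mul0r.
Qed.

Lemma sum_alive (S H : {set V}) (F : V -> R) : H \subset S ->
  \sum_(v in S) (v \in H)%:R * F v = \sum_v (v \in H)%:R * F v.
Proof.
move=> HS; rewrite [RHS](bigID (mem S)) /= [X in _ + X]big1 ?addr0 // => v vS.
have /negbTE-> : v \notin H by apply: contra vS; apply: subsetP.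
by rewrite mul0r.
Qed.

Lemma codeg_ge0 (H : {set V}) x y : 0 <= codeg R e H x y.
Proof. by apply: sumr_ge0 => z _; rewrite !mulr_ge0. Qed.

(** The arrival of b turns theta into a gain valued 1 + deg / 2, with the new degree of a. Any other
    arrival keeps the value 1/2 unless it ends the life of a, and the chance of that through the
    alive neighbours of a pays for the deg / 2. The slack is half the codegree when b is alive. *)
Lemma theta_step_edge g a b (S : {set V}) (st : state R V) :
  alive st \subset S -> a \in alive st -> e a b -> b \in S ->
  \sum_(v in S) ((e v a)%:R * (v == b)%:R *
       (1 + deg R e (alive (arrive e g st v)) a / 2)
     + theta a b (S :\ v) (arrive e g st v)) <= #|S|%:R * theta a b S st.
Proof.
move=> HS aH ab bS; have aS := subsetP HS a aH.
have nab : a != b by apply: contraTneq ab => ->; rewrite e_irr.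
rewrite (big_setD1 b bS) /= e_sym ab eqxx !mul1r deg_arrive // ab.
rewrite {1}/theta ab !inE eqxx mulr0 addr0.
set H := alive st in HS aH *.
have -> : \sum_(v in S :\ b) ((e v a)%:R * (v == b)%:R *
       (1 + deg R e (alive (arrive e g st v)) a / 2)
     + theta a b (S :\ v) (arrive e g st v)) =
  \sum_(v in S :\ b) (1 - (a == v)%:R * (v \in H)%:R - (v \in H)%:R * (e a v)%:R) / 2.
  apply: eq_bigr => v /setD1P[vb vS]; rewrite (negbTE vb) mulr0 mul0r add0r /theta.
  rewrite alive_arrive // ab aH !inE (eq_sym b v) vb bS (e_sym v a) (eq_sym a v) /=.
  by rewrite -/H; ring.
rewrite -big_distrl /= !sumrB sumr_const sum_indic ?inE ?nab // aH.
have -> : #|S|%:R = 1 + #|S :\ b|%:R :> R by rewrite (cardsD1 b S) bS natrD.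
have -> : deg R e H a = (b \in H)%:R + \sum_(v in S :\ b) (v \in H)%:R * (e a v)%:R.
  by rewrite /deg -(sum_alive _ HS) (big_setD1 b bS) /= ab mulr1.
rewrite /theta ab bS aH /=.
by case: (b \in H) => /=; have := codeg_ge0 H b a; lra.
Qed.

Lemma theta_step_nonedge g a b (S : {set V}) (st : state R V) :
  alive st \subset S -> {in alive st, forall x, killer st x = None} ->
  a \in alive st -> a != b -> ~~ e a b ->
  \sum_(v in S) ((e v a)%:R * (killer st v == Some b)%:R *
       (1 + deg R e (alive (arrive e g st v)) a / 2)
     + theta a b (S :\ v) (arrive e g st v)) <= #|S|%:R * theta a b S st.
Proof.
move=> HS HK aH nab ab; have aS := subsetP HS a aH.
rewrite /theta (negbTE ab) aH.
set H := alive st in HS HK aH *.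
(* Indicator of a pending centre: a neighbour of a settled by b, whose arrival marks the pair.
   Having a killer, it is not alive. *)
pose mk x : R := ((e a x) && (killer st x == Some b))%:R.
have mkH x : (x \in H)%:R * mk x = 0.
  by case: (boolP (x \in H)) => xH; rewrite ?mul0r // /mk HK // andbF mulr0.
set m := \sum_(x in S) mk x.
(* New pending centres appear only when b arrives as a pivot, at most one per common alive neighbour
   of a and b. *)
have mle v : v \in S ->
  \sum_(x in S :\ v) (e a x && (killer (arrive e g st v) x == Some b))%:R
   <= m - mk v + (b == v)%:R * (b \in H)%:R * codeg R e H b a.
  move=> vS;
  have -> : m - mk v = \sum_(x in S :\ v) mk x.
    by rewrite /m (big_setD1 v vS) /=; lra.
  pose F x : R := (b == v)%:R * (b \in H)%:R * ((x \in H)%:R * (e b x)%:R * (e a x)%:R).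
  have F0 x : 0 <= F x by rewrite !mulr_ge0.
  apply: le_trans (_ : \sum_(x in S :\ v) mk x + \sum_(x in S :\ v) F x <= _); last first.
    rewrite lerD2l /codeg big_distrr /= -/F [leRHS](bigID (mem (S :\ v))) /=.
    by rewrite lerDl; apply: sumr_ge0 => x _; apply: F0.
  rewrite -big_split; apply: ler_sum => x _; move: (F0 x); rewrite /mk /F /= -/H.
  case: (e a x) => /= F0x; last by rewrite add0r.
  case: ifP => [/and3P[vH xH vx]|_]; last by rewrite lerDl.
  rewrite (inj_eq Some_inj) eq_sym; move: F0x.
  have [->|_] := eqVneq b v => F0x; last by rewrite addr_ge0.
  by rewrite vH xH vx; case: (killer st x == Some v) => /=; lra.
have m_ge0 : 0 <= m by apply: sumr_ge0 => x _.
have term v : v \in S ->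
  (e v a)%:R * (killer st v == Some b)%:R *
   (1 + deg R e (alive (arrive e g st v)) a / 2) +
   (a \in alive (arrive e g st v))%:R / 2 *
    ((b \in alive (arrive e g st v))%:R + \sum_(x in S :\ v)
      (e a x && (killer (arrive e g st v) x == Some b))%:R) <=
  mk v * (1 + deg R e H a / 2) + 
  2^-1 * ((b \in H)%:R * (1 - (a == v)%:R - (b == v)%:R * (1 - codeg R e H b a)
    - (v \in H)%:R * (e a v)%:R * (e b v)%:R)
  + (m * (1 - (a == v)%:R - (v \in H)%:R * (e a v)%:R) - mk v)).
  move=> vS; set A := (a \in alive (arrive e g st v))%:R.
  have A0 : 0 <= A by [].
  (* A marking arrival is not a pivot, so it leaves a alive. *)
  have Amk : A * mk v = mk v.
    rewrite /A alive_arrive // -/H aH mul1r mulrBl mul1r -mulrA mulrCA mkH.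
    by rewrite mulr0 subr0.
  have := ler_wpM2l A0 (mle v vS); move: (\sum_(x in S :\ v) _) => m' Am'.
  have -> : (e v a)%:R * (killer st v == Some b)%:R = mk v.
    by rewrite /mk (e_sym v a) -mulnb natrM.
  have dle : mk v * (1 + deg R e (alive (arrive e g st v)) a / 2) <=
      mk v * (1 + deg R e H a / 2).
    rewrite ler_wpM2l // lerD2l ler_pM2r ?invr_gt0 ?ltr0n // deg_arrive // -/H.
    by rewrite gerBl mulr_ge0 // addr_ge0 // codeg_ge0.
  suff : A * (b \in alive (arrive e g st v))%:R +
       A * (m + (b == v)%:R * (b \in H)%:R * codeg R e H b a)
     <= (b \in H)%:R * (1 - (a == v)%:R - (b == v)%:R * (1 - codeg R e H b a)
    - (v \in H)%:R * (e a v)%:R * (e b v)%:R)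
  + m * (1 - (a == v)%:R - (v \in H)%:R * (e a v)%:R) by move: Am' Amk dle; lra.
  rewrite /A !alive_arrive // -/H aH.
  rewrite (e_sym v a) (e_sym v b); have [<-|nav] := eqVneq a v.
    by rewrite aH (eq_sym b) (negbTE nab) e_irr /=; lra.
  have [<-|nbv] := eqVneq b v.
    by rewrite (negbTE ab) e_irr /=; case: (b \in H) => /=; lra.
  by case: (b \in H); case: (v \in H); case: (e a v); case: (e b v) => /=; lra.
apply: le_trans (ler_sum _ term) _.
rewrite big_split /= -big_distrl -big_distrr /= -/m big_split /= !sumrB -/m.
have -> : \sum_(v in S) m * (1 - (a == v)%:R - (v \in H)%:R * (e a v)%:R) =
    m * (#|S|%:R - 1 - deg R e H a).
  rewrite -big_distrr /= !sumrB sumr_const /deg -(sum_alive _ HS).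
  by under [X in _ - X - _]eq_bigr => v _ do rewrite -[_%:R]mulr1; rewrite sum_indic.
case: (boolP (b \in H)) => bH; last first.
  rewrite big1 => [|v _]; last by rewrite mul0r.
  by rewrite /=; lra.
have bS := subsetP HS b bH.
rewrite -big_distrr /= !sumrB sumr_const sum_indic //.
under [X in _ - X - _ - _]eq_bigr => v _ do rewrite -[_%:R]mulr1.
rewrite sum_indic //.
have -> : codeg R e H b a = \sum_(i in S) (i \in H)%:R * (e a i)%:R * (e b i)%:R.
  under [RHS]eq_bigr => i _ do rewrite -mulrA (mulrC (e a i)%:R).
  by rewrite (sum_alive _ HS); apply: eq_bigr => i _; rewrite mulrA.
by lra.
Qed.

Lemma theta_step g a b (S : {set V}) (st : state R V) :
  alive st \subset S -> {in alive st, forall x, killer st x = None} -> a != b ->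
  \sum_(v in S) (\sum_y (y \in alive st)%:R * (e v y)%:R *
       mark a b v (killer st v) y * (1 + deg R e (alive (arrive e g st v)) y / 2)
     + theta a b (S :\ v) (arrive e g st v)) <= #|S|%:R * theta a b S st.
Proof.
move=> HS HK nab.
have simp v : \sum_y (y \in alive st)%:R * (e v y)%:R *
    mark a b v (killer st v) y * (1 + deg R e (alive (arrive e g st v)) y / 2) =
  (a \in alive st)%:R *
   ((e v a)%:R * (if e a b then v == b else killer st v == Some b)%:R *
    (1 + deg R e (alive (arrive e g st v)) a / 2)).
  rewrite (bigD1 a) //= big1 ?addr0 => [|y /negbTE ya].
    by rewrite /mark eqxx !mulrA.
  by rewrite /mark ya mulr0 mul0r.
under eq_bigr => v _ do rewrite simp.
have th0 v : a \notin alive st -> theta a b (S :\ v) (arrive e g st v) = 0.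
  by move=> /negbTE aH; rewrite /theta alive_arrive // aH !mul0r.
case: (boolP (a \in alive st)) => aH; last first.
  rewrite big1 => [|v _]; last by rewrite mul0r add0r th0.
  by apply: mulr_ge0; rewrite ?theta_ge0.
under eq_bigr => v _ do rewrite mul1r.
case: (boolP (e a b)) => ab; last exact: theta_step_nonedge.
case: (boolP (b \in S)) => bS; first exact: theta_step_edge.
rewrite big1 => [|v vS]; first by apply: mulr_ge0; rewrite ?theta_ge0.
have -> : (v == b) = false by apply: contraNF bS => /eqP<-.
by rewrite mulr0 mul0r /theta ab !inE (negbTE bS) andbF mulr0 addr0.
Qed.

End Theta.

(** * The expected total reward over all arrival orders *)

Section Total.

Local Open Scope ring_scope.

Variables (R : realFieldType) (V : finType) (e : rel V).
Hypotheses (e_sym : symmetric e) (e_irr : irreflexive e).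
Variable D : {set V * V}.
Hypothesis D_neq : {in D, forall x, x.1 != x.2}.

Definition gain (v : V) (k : option V) (y : V) : R :=
  \sum_(x in D) mark R e x.1 x.2 v k y.

Local Notation step := (arrive e gain).

Fixpoint total_reward (st : state R V) (t : seq V) : R :=
  if t is v :: t' then reward e st v + total_reward (step st v) t' else 0.

Definition potential (S : {set V}) (st : state R V) : R :=
  \sum_(y in S) weight st y * (1 + deg R e (alive st) y / 2)
  + \sum_(x in D) theta e x.1 x.2 S st.

Lemma potential_arrive (S : {set V}) st :
  alive st \subset S -> {in alive st, forall x, killer st x = None} ->
  \sum_(v in S) (reward e st v + potential (S :\ v) (step st v)) <=
  #|S|%:R * potential S st.
Proof.
move=> HS HK; rewrite /potential.
under eq_bigr => v _ do rewrite addrA.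
rewrite big_split /= potential_step // mulrDr -addrA lerD2l.
rewrite mulr_sumr [X in _ + X <= _]exchange_big /=.
have -> : \sum_(v in S) \sum_y
     (y \in alive st)%:R * (e v y)%:R * gain v (killer st v) y *
   (1 + deg R e (alive (step st v)) y / 2) =
   \sum_(x in D) \sum_(v in S) \sum_y (y \in alive st)%:R * (e v y)%:R *
     mark R e x.1 x.2 v (killer st v) y * (1 + deg R e (alive (step st v)) y / 2).
  rewrite [RHS]exchange_big; apply: eq_bigr => v _ /=.
  rewrite [RHS]exchange_big; apply: eq_bigr => y _ /=.
  by rewrite /gain mulr_sumr mulr_suml.
rewrite -big_split; apply: ler_sum => x xD; rewrite -big_split.
by apply: theta_step => //; apply: D_neq.
Qed.

(** Induction on the first arrival: each choice of it leaves n! orders, and averaging over the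
    choices is [potential_arrive]. When no vertex remains, the potential is a sum of nonnegative
    thetas. *)
Lemma total_permutations (s : seq V) st : uniq s ->
  alive st \subset [set x in s] -> {in alive st, forall x, killer st x = None} ->
  \sum_(t <- permutations s) total_reward st t <=
  (size s)`!%:R * potential [set x in s] st.
Proof.
move: {2}(size s) (erefl (size s)) => n; elim: n => [|n IHn] in s st *.
  move=> /size0nil-> _ _ _; rewrite big_seq1 mul1r /potential.
  rewrite [X in X + _]big1 => [|y]; last by rewrite inE.
  by rewrite add0r; apply: sumr_ge0 => x _; apply: theta_ge0.
move=> sz us HS HK; rewrite (perm_big _ (permutationsE _)) ?sz //=.
rewrite undup_id // big_allpairs_dep /=.
have inner v : v \in s ->
    \sum_(t <- permutations (rem v s)) total_reward st (v :: t) <=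
    n`!%:R * (reward e st v + potential ([set x in s] :\ v) (step st v)).
  move=> vs; rewrite big_split /= mulrDr.
  have szr : size (rem v s) = n by rewrite size_rem // sz.
  rewrite big_const_seq count_predT size_permutations ?rem_uniq // szr.
  rewrite iter_addr_0 mulr_natl lerD2l.
  have -> : [set x in s] :\ v = [set x in rem v s].
    by apply/setP => x; rewrite !inE mem_rem_uniq // inE.
  rewrite -szr; apply: IHn => //; first by rewrite rem_uniq.
    apply/subsetP => x; rewrite inE mem_rem_uniq // inE /arrive /=.
    case: ifP => vH; rewrite ?inE => xH.
      case/andP: xH; rewrite negb_or => /andP[-> _] /(subsetP HS).
      by rewrite inE.
    have := subsetP HS _ xH; rewrite inE => ->; rewrite andbT.
    by apply: contraFneq vH => <-.
  move=> x; rewrite /arrive /=.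
  case: ifP => [vH|vH xH]; last by rewrite HK.
  by rewrite !inE negb_or => /andP[/andP[_ /negbTE vx] xH]; rewrite vx andbF HK.
rewrite big_seq; apply: le_trans (ler_sum _ inner) _; rewrite -big_seq.
rewrite -mulr_sumr factS natrM -mulrA mulrCA ler_wpM2l //.
pose F v := reward e st v + potential ([set x in s] :\ v) (step st v).
have -> : \sum_(v <- s) F v = \sum_(v in [set x in s]) F v.
  by rewrite big_uniq //; apply: eq_bigl => v; rewrite inE.
have -> : n.+1 = #|[set x in s]| by rewrite cardsE (card_uniqP us) sz.
exact: potential_arrive.
Qed.

Definition start : state R V := State setT (fun=> 0) (fun=> None).

Definition arrivals (p : {perm V}) : seq V := map (p^-1)%g (enum V).

Lemma perm_arrivals p : perm_eq (arrivals p) (enum V).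
Proof.
apply: uniq_perm; rewrite ?enum_uniq //.
  by rewrite map_inj_uniq ?enum_uniq //; apply: perm_inj.
move=> x; rewrite mem_enum; apply/mapP; exists (p x); rewrite ?mem_enum //.
by rewrite permK.
Qed.

Lemma arrivals_inj : injective arrivals.
Proof.
move=> p q /eq_in_map pq; apply: invg_inj; apply/permP => x.
by apply: pq; rewrite mem_enum.
Qed.

(** [arrivals] is an injection between sets of size #|V|!, hence meets every order once. Initially
    all weights are 0 and each theta is 1/2. *)
Lemma sum_total_arrivals :
  \sum_(p : {perm V}) total_reward start (arrivals p) <=
    #|{: {perm V}}|%:R * (#|D|%:R / 2).
Proof.
have [uE szE] : uniq (enum V) /\ size (enum V) = #|V| by rewrite enum_uniq cardE.
have cardP : #|{: {perm V}}| = #|V|`!.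
  rewrite -[#|V|]cardsT -card_perm; apply: eq_card => p; rewrite !inE.
  exact/esym/subsetP.
have -> : \sum_(p : {perm V}) total_reward start (arrivals p) =
    \sum_(t <- permutations (enum V)) total_reward start t.
  rewrite -big_enum -(big_map arrivals predT (total_reward start)) /=; apply: perm_big.
  have uo : uniq [seq arrivals p | p <- enum {: {perm V}}].
    by rewrite map_inj_uniq ?enum_uniq //; apply: arrivals_inj.
  apply: uniq_perm; rewrite ?permutations_uniq //.
  have [] := uniq_min_size uo (s2 := permutations (enum V)).
  - by move=> _ /mapP[p _ ->]; rewrite mem_permutations perm_arrivals.
  - by rewrite size_permutations // szE size_map -cardE cardP.
  by [].
rewrite cardP -szE; apply: le_trans (total_permutations uE _ _) _ => //.
  by apply/subsetP => x; rewrite inE mem_enum.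
rewrite ler_wpM2l // /potential [X in X + _]big1 => [|y _]; last by rewrite mul0r.
rewrite add0r -sumr_const mulr_suml; apply: ler_sum => x _.
rewrite /theta /= !inE; case: ifP => _.
  by rewrite mem_enum mulr1.
by rewrite big1 ?addr0 ?mulr1 // => y _; rewrite andbF.
Qed.

End Total.

(** * An interface for the assignment of vertices to pivots *)

Section Eliminator.

Variables (V : finType) (e : rel V) (p : {perm V}).

(** The fixed points of [elm] are the pivots, and every vertex goes to the lowest pivot of its
    closed neighbourhood. This lets the clusterings be compared without the arrival process. *)
Record eliminator (elm : V -> V) : Prop := Eliminator {
  elm_adj : forall v, elm v = v \/ e (elm v) v;
  elm_idem : forall v, elm (elm v) = elm v;
  elm_min : forall u v, elm u = u -> u = v \/ e u v ->
    (rank p (elm v) <= rank p u)%N;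
  elm_rank : forall v, (rank p (elm v) <= rank p v)%N }.

End Eliminator.

(** * The arrival process along one permutation *)

Section Run.

Local Open Scope ring_scope.

Variables (R : realFieldType) (V : finType) (e : rel V).
Hypotheses (e_sym : symmetric e) (e_irr : irreflexive e).
Variable D : {set V * V}.
Variable p : {perm V}.

Local Notation gain := (gain R e D).
Local Notation step := (arrive e gain).

Definition state_at k : state R V := foldl step (start R V) (take k (arrivals p)).

Lemma rank_lt v : (rank p v < #|V|)%N.
Proof. exact: ltn_ord. Qed.

Lemma rank_surj k : (k < #|V|)%N -> exists v, rank p v = k.
Proof.
move=> kV; exists ((p^-1)%g (enum_val (Ordinal kV))).
by rewrite /rank permKV enum_valK.
Qed.

Lemma size_arrivals : size (arrivals p) = #|V|.
Proof. by rewrite size_map -cardE. Qed.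

Lemma nth_arrivals v : nth v (arrivals p) (rank p v) = v.
Proof.
by rewrite (nth_map v) -?cardE ?rank_lt // nth_enum_rank permK.
Qed.

Lemma index_arrivals v : index v (arrivals p) = rank p v.
Proof.
rewrite -{1}(nth_arrivals v) index_uniq ?size_arrivals ?rank_lt //.
by rewrite (perm_uniq (perm_arrivals p)) enum_uniq.
Qed.

Lemma state_at_step v :
  state_at (rank p v).+1 = step (state_at (rank p v)) v.
Proof.
by rewrite /state_at (take_nth v) ?size_arrivals ?rank_lt // foldl_rcons nth_arrivals.
Qed.

Lemma state_ind (P : nat -> state R V -> Prop) : P 0 (start R V) ->
  (forall v, P (rank p v) (state_at (rank p v)) ->
     P (rank p v).+1 (step (state_at (rank p v)) v)) ->
  forall k, (k <= #|V|)%N -> P k (state_at k).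
Proof.
move=> P0 PS; elim=> [|k IHk] kV; first by rewrite /state_at take0.
have [v vk] := rank_surj kV; move: (IHk (ltnW kV)); rewrite -vk => /PS.
by rewrite state_at_step.
Qed.

Definition eliminators : {set V} := [set v | v \in alive (state_at (rank p v))].

Lemma alive_stateP k x : (k <= #|V|)%N ->
  reflect (forall u, u \in eliminators -> (rank p u < k)%N -> u <> x /\ ~~ e u x)
    (x \in alive (state_at k)).
Proof.
move=> kV; apply: (iffP idP); move: k kV.
  apply: (state_ind (P := fun k st => x \in alive st -> forall u,
    u \in eliminators -> (rank p u < k)%N -> u <> x /\ ~~ e u x)) => // v IH.
  rewrite /arrive /=; case: ifP => vH xH u uM;
    rewrite ltnS leq_eqVlt => /orP[/eqP/rank_inj uv|uk].
  - subst u; move: xH; rewrite !inE negb_or => /andP[/andP[xv exv] _].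
    by split=> // vx; rewrite vx eqxx in xv.
  - by apply: IH => //; move: xH; rewrite !inE => /andP[].
  - by move: uM; rewrite uv inE vH.
  - exact: IH.
apply: (state_ind (P := fun k st => (forall u, u \in eliminators ->
  (rank p u < k)%N -> u <> x /\ ~~ e u x) -> x \in alive st)) => [_|v IH H].
  by rewrite inE.
have xH : x \in alive (state_at (rank p v)).
  by apply: IH => u uM uk; apply: H => //; rewrite ltnW.
rewrite /arrive /=; case: ifP => // vH.
have [|//|vx evx] := H v; first by rewrite inE.
by rewrite !inE (negbTE evx) xH orbF !andbT; apply/eqP => xv; apply: vx.
Qed.

Definition elm (v : V) : V :=
  if lowest p (eliminators :&: (v |: nbhd e v)) is Some u then u else v.

Lemma elmP v : [/\ elm v \in eliminators, elm v = v \/ e (elm v) v &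
  forall u, u \in eliminators -> u = v \/ e u v -> (rank p (elm v) <= rank p u)%N].
Proof.
rewrite /elm; case E: lowest => [u|].
  have [] := lowest_Some E; rewrite !inE => /andP[uM uv] umin; split=> //.
    by case/orP: uv => [/eqP|]; [left | right; rewrite e_sym].
  move=> w wM wv; apply: umin; rewrite !inE in wM *; rewrite wM /=.
  by case: wv => [->|]; rewrite ?eqxx // e_sym => ->; rewrite orbT.
(* A vertex with no pivot in its closed neighbourhood would be alive on arrival, hence a pivot
   itself; so the default of [elm] is never taken. *)
have M0 := lowest_None E; exfalso.
have vM : v \notin eliminators.
  apply/negP => vM; have : v \in set0 by rewrite -M0 in_setI vM in_setU1 eqxx.
  by rewrite inE.
move: (vM); rewrite inE; case/alive_stateP => [|u uM _]; first exact/ltnW/rank_lt.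
split; first by move=> uv; rewrite uv (negbTE vM) in uM.
apply/negP => uv; have : u \in set0; last by rewrite inE.
by rewrite -M0 in_setI uM !inE e_sym uv orbT.
Qed.

Lemma alive_elm k x : (k <= #|V|)%N ->
  (x \in alive (state_at k)) = (k <= rank p (elm x))%N.
Proof.
have [eM ex emin] := elmP x => kV.
apply/alive_stateP/idP => // [H|kx u uM uk].
  by rewrite leqNgt; apply/negP => /(H _ eM)[nx] /negP; case: ex.
split=> [ux|]; first by have := leq_trans kx (emin u uM (or_introl ux)); rewrite leqNgt uk.
by apply/negP => ux; have := leq_trans kx (emin u uM (or_intror ux)); rewrite leqNgt uk.
Qed.

Lemma elm_eliminator : eliminator e p elm.
Proof.
(* Of two adjacent pivots, the earlier would have ended the life of the later. *)
have Mind u v : u \in eliminators -> v \in eliminators -> ~~ e u v.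
  wlog uv : u v / (rank p u < rank p v)%N => [H uM vM|uM].
    case: (ltngtP (rank p u) (rank p v)) => [uv|vu|/rank_inj->]; first exact: H.
      by rewrite e_sym; apply: H.
    by rewrite e_irr.
  rewrite inE => /alive_stateP-/(_ (ltnW (rank_lt v))) H.
  by have [] := H u uM uv.
have elmM v : v \in eliminators -> elm v = v.
  move=> vM; have [eM ev _] := elmP v; case: ev => // ev.
  by have := Mind _ _ eM vM; rewrite ev.
split=> [v|v|u v uu|v]; have [eM ev emin] := elmP v => //.
- exact: elmM.
- by apply: emin; have [uM _ _] := elmP u; rewrite -uu.
case: (boolP (v \in eliminators)) => [/elmM->//|]; rewrite inE.
by rewrite alive_elm ?(ltnW (rank_lt v)) // -ltnNge => /ltnW.
Qed.

Let EL := elm_eliminator.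

Lemma killer_elm k y : (k <= #|V|)%N -> killer (state_at k) y =
  if (rank p (elm y) < k)%N && (elm y != y) then Some (elm y) else None.
Proof.
move: k; apply: (state_ind (P := fun k st => killer st y =
  if (rank p (elm y) < k)%N && (elm y != y) then Some (elm y) else None)) => // v IH.
have vV := ltnW (rank_lt v).
rewrite /arrive /= !alive_elm // IH ltnS.
case: (boolP (elm v == v)) => [/eqP ev|]; last first.
  move=> nev; have /negbTE-> : ~~ (rank p v <= rank p (elm v))%N.
    rewrite leqNgt negbK ltn_neqAle (elm_rank EL) andbT.
    by apply: contra nev => /eqP/rank_inj->.
  rewrite [(rank p (elm y) <= rank p v)%N]leq_eqVlt.
  case: (rank p (elm y) =P rank p v) => [/rank_inj ey|//]; subst v.
  by rewrite (elm_idem EL) eqxx in nev.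
rewrite ev leqnn /=; case: (boolP (e v y)) => evy; last first.
  rewrite andbF [(rank p (elm y) <= rank p v)%N]leq_eqVlt.
  case: (rank p (elm y) =P rank p v) => [/rank_inj ey|//].
  move: (elm_adj EL y); rewrite ey => -[<-|]; first by rewrite ltnn eqxx.
  by rewrite (negbTE evy).
have vy := elm_min EL ev (or_intror evy).
rewrite andbT; case: leqP => ky /=.
  have -> : elm y = v by apply/(@rank_inj _ p)/eqP; rewrite eqn_leq ky vy.
  rewrite leqnn; case: eqP => // vy'.
  by rewrite vy' e_irr in evy.
by rewrite (ltnW ky).
Qed.

Lemma mark_ge0 a b v k y : 0 <= mark R e a b v k y.
Proof. by []. Qed.

Lemma gain_ge0 v k y : 0 <= gain v k y.
Proof. by apply: sumr_ge0 => x _; apply: mark_ge0. Qed.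

Lemma weight_ge0 k : (k <= #|V|)%N -> forall y, 0 <= weight (state_at k) y.
Proof.
move: k; apply: (state_ind (P := fun k st => forall y, 0 <= weight st y)) => // v IH y.
by rewrite /arrive /= addr_ge0 ?mulr_ge0 ?addr_ge0 ?gain_ge0.
Qed.

Lemma weight_mono k k' y : (k <= k')%N -> (k' <= #|V|)%N ->
  weight (state_at k) y <= weight (state_at k') y.
Proof.
elim: k' => [|k' IH]; first by rewrite leqn0 => /eqP->.
rewrite leq_eqVlt => /orP[/eqP->//|kk'] k'V.
apply: le_trans (IH kk' (ltnW k'V)) _.
have [v vk'] := rank_surj k'V; rewrite -vk' state_at_step /arrive /= lerDl.
by rewrite !mulr_ge0 // addr_ge0 ?gain_ge0 ?weight_ge0 // ltnW ?rank_lt.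
Qed.

Definition final_weight v : R := weight (state_at (rank p v)) v.

(** The rank condition says that y is still alive when x arrives, so y does query x; afterwards
    weights only grow. *)
Lemma weight_call x y k : e x y -> (rank p x < k)%N -> (k <= #|V|)%N ->
  (rank p x <= rank p (elm y))%N ->
  final_weight x + gain x (killer (state_at (rank p x)) x) y
    <= weight (state_at k) y.
Proof.
move=> xy xk kV xey; apply: le_trans (weight_mono _ xk kV).
rewrite state_at_step /arrive /= alive_elm ?(ltnW (rank_lt x)) // xey xy !mul1r.
by rewrite lerDr weight_ge0 // ltnW ?rank_lt.
Qed.

Lemma total_foldl st (t : seq V) : uniq t ->
  total_reward e D st t = \sum_(v <- t) reward e (foldl step st (take (index v t) t)) v.
Proof.
elim: t st => [|x t IH] st /=; first by rewrite big_nil.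
move=> /andP[xt ut]; rewrite big_cons eqxx IH //; congr (_ + _).
apply: eq_big_seq => v vt; case: eqP => [xv|//].
by rewrite xv vt in xt.
Qed.

Lemma total_arrivals :
  total_reward e D (start R V) (arrivals p) = \sum_v reward e (state_at (rank p v)) v.
Proof.
rewrite total_foldl; last by rewrite (perm_uniq (perm_arrivals p)) enum_uniq.
rewrite (perm_big _ (perm_arrivals p)) /= big_enum /=.
by apply: eq_bigr => v _; rewrite index_arrivals.
Qed.

(** A pair x, y is rewarded only at the arrival of v = [elm x], which must also be [elm y]; the sum
    over v collapses to that term. *)
Lemma total_lower_bound : total_reward e D (start R V) (arrivals p) =
  \sum_v final_weight v + 6^-1 * \sum_x \sum_y
    ([&& elm x == elm y, x != elm x & y != elm y] && e x y)%:R *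
    (final_weight (elm x) + weight (state_at (rank p (elm x))) x
     + weight (state_at (rank p (elm x))) y).
Proof.
rewrite total_arrivals big_split /= -big_distrr /=; congr (_ + _ * _).
rewrite exchange_big; apply: eq_bigr => x _.
rewrite exchange_big; apply: eq_bigr => y _ /=.
have alive_adj v z : [&& v \in alive (state_at (rank p v)),
      z \in alive (state_at (rank p v)) & e v z] = (v == elm z) && (z != elm z).
  rewrite !alive_elm ?(ltnW (rank_lt v)) //.
  apply/idP/idP => [/and3P[vv vz evz]|/andP[/eqP-> zz]].
    have ev : elm v = v by apply/(@rank_inj _ p)/eqP; rewrite eqn_leq vv (elm_rank EL).
    have <- : v = elm z.
      apply/(@rank_inj _ p)/eqP; rewrite eqn_leq vz /=.
      by apply: (elm_min EL) => //; right.
    by rewrite eqxx /=; apply: contraTneq evz => ->; rewrite e_irr.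
  rewrite (elm_idem EL) leqnn; case: (elm_adj EL z) => // zE.
  by rewrite zE eqxx in zz.
have indic v : [&& v \in alive (state_at (rank p v)),
      x \in alive (state_at (rank p v))
      & y \in alive (state_at (rank p v))] && [&& e v x, e v y & e x y] =
    [&& (v == elm x) && (x != elm x), (v == elm y) && (y != elm y) & e x y].
  rewrite -!alive_adj; case: (v \in _); case: (x \in _); case: (y \in _);
  by case: (e v x); case: (e v y); case: (e x y).
under eq_bigr => v _ do rewrite indic.
rewrite (bigD1 (elm x)) //= big1 ?addr0 => [|v /negbTE->]; last by rewrite mul0r.
rewrite eqxx /=; case: (elm x == elm y); case: (x != elm x);
by case: (y != elm y); case: (e x y).
Qed.

End Run.

(** * Comparison of the PIVOT and r-PIVOT clusterings *)

Section Clusters.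

Variables (V : finType) (e : rel V).
Hypotheses (e_sym : symmetric e) (e_irr : irreflexive e).
Variables (p : {perm V}) (elm : V -> V).
Hypothesis EL : eliminator e p elm.

Lemma elm_unique x u : elm u = u -> u = x \/ e u x ->
  rank p u <= rank p (elm x) -> elm x = u.
Proof.
move=> uu ux le; apply/(@rank_inj _ p)/eqP.
by rewrite eqn_leq le (elm_min EL).
Qed.

Lemma elm_edge x : elm x != x -> e (elm x) x.
Proof. by case: (elm_adj EL x) => // ->; rewrite eqxx. Qed.

Lemma elm_rank_lt x : elm x != x -> rank p (elm x) < rank p x.
Proof.
by rewrite ltn_neqAle (elm_rank EL) andbT; apply: contra => /eqP/rank_inj->.
Qed.

(** Loop invariant: the remaining vertices are a union of fibres of [elm], and each cluster formed
    is one fibre. *)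
Lemma eq_pblock_pivot x y :
  (pblock (pivot e p) x == pblock (pivot e p) y) = (elm x == elm y).
Proof.
pose inv (s : {set V} * {set {set V}}) :=
  (forall x, (elm x \in s.1) = (x \in s.1)) /\
  (forall B, B \in s.2 -> exists c, B = [set y | elm y == c]).
have [_ blocks] : inv (iter #|V| (pivot_step e p) ([set: V], set0)).
  elim: #|V| => [|k]; first by split=> [z|B]; rewrite !inE.
  rewrite iterS; case: (iter _ _ _) => Rem P [/= RP PP]; rewrite /pivot_step /=.
  case low: lowest => [v|//]; have [vR vmin] := lowest_Some low.
  have ev : elm v = v.
    apply/(@rank_inj _ p)/eqP; rewrite eqn_leq (elm_rank EL) vmin // RP //.
  have CE z : (z \in Rem :&: (v |: nbhd e v)) = (elm z == v).
    rewrite !inE; apply/idP/eqP => [/andP[zR zv]|ez].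
      apply: elm_unique => //; last by rewrite vmin // RP.
      by case/orP: zv => [/eqP|]; [left | right].
    rewrite -RP ez vR /=; case: (elm_adj EL z); rewrite ez; first by move->; rewrite eqxx.
    by move->; rewrite orbT.
  split=> /= [z|B]; first by rewrite in_setD CE in_setD CE (elm_idem EL) RP.
  by case/setU1P => [->|/PP//]; exists v; apply/setP => z; rewrite CE inE.
have /and3P[/eqP cov triv _] := pivot_partition e p.
rewrite eq_pblock ?cov ?inE //.
have xcov : x \in cover (pivot e p) by rewrite cov inE.
have [c xc] := blocks _ (pblock_mem xcov).
by move: xcov; rewrite -mem_pblock xc !inE => /eqP<-; rewrite eq_sym.
Qed.

Lemma elm_nonadj u v : elm u = u -> elm v = v -> ~~ e u v.
Proof.
move=> uu vv; apply/negP => uv.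
have le1 := elm_min EL uu (or_intror uv); rewrite vv in le1.
have le2 : rank p (elm u) <= rank p v by apply: (elm_min EL) => //; right; rewrite e_sym.
have E : u = v by apply/(@rank_inj _ p)/eqP; rewrite eqn_leq -{1}uu le2 le1.
by move: uv; rewrite E e_irr.
Qed.

Variable r : nat.
Local Notation pivots j := (rpivot_state e j p).1.
Local Notation unsettled j := (rpivot_state e j p).2.
Local Notation leader := (rpivot_leader e r p).

Lemma eq_pblock_rpivot x y :
  (pblock (rpivot e r p) x == pblock (rpivot e r p) y) = (leader x == leader y).
Proof.
have /and3P[/eqP cov triv _] := preim_partitionP leader [set: V].
rewrite eq_pblock ?cov ?inE // /rpivot /preim_partition.
rewrite pblock_equivalence_partition ?inE //.
by move=> u v w _ _ _ /=; split=> // /eqP->.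
Qed.

Lemma pivotsS j v : (v \in pivots j.+1) = (v \in pivots j) ||
  (v \in unsettled j) && [forall u in unsettled j :&: nbhd e v, rank p v < rank p u].
Proof.
by rewrite /rpivot_state iterS -/(rpivot_state e j p) /= !inE.
Qed.

Lemma unsettledP j u : reflect
  (u \notin pivots j /\ {in pivots j, forall v, ~~ e v u}) (u \in unsettled j).
Proof.
elim: j => [|j IH] in u *.
  by apply: (iffP idP); rewrite !inE => // _; split=> // v; rewrite inE.
have -> : (u \in unsettled j.+1) =
    [&& u \in unsettled j, u \notin pivots j.+1
      & u \notin \bigcup_(v in pivots j.+1) nbhd e v].
  rewrite {1 2}/rpivot_state !iterS -/(rpivot_state e j p) /=.
  by rewrite in_setD in_setU negb_or andbC.
apply: (iffP and3P) => [[_ uP uN]|[uP uN]].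
  split=> // v vP; apply: contra uN => vu; apply/bigcupP; exists v => //.
  by rewrite inE.
split=> //.
  apply/IH; split=> [|v vP]; last by apply: uN; rewrite pivotsS vP.
  by apply: contra uP => uP; rewrite pivotsS uP.
by apply/bigcupP => -[v vP]; rewrite inE; apply/negP/uN.
Qed.

(** Otherwise the earlier neighbour [elm v] is settled when v is marked. It is then a marked pivot
    next to the unsettled v, or adjacent to a marked pivot; both are impossible. *)
Lemma pivots_elm j v : v \in pivots j -> elm v = v.
Proof.
elim: j v => [|j IH] v; first by rewrite inE.
rewrite pivotsS => /orP[/IH//|/andP[/unsettledP[vP vN] /forall_inP vmin]].
apply/eqP; apply/contraT => nev.
have [ev ltv] := (elm_edge nev, elm_rank_lt nev).
have : elm v \notin unsettled j.
  apply/negP => eU; have := vmin (elm v).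
  by rewrite !inE eU e_sym ev ltnNge (ltnW ltv) => /(_ isT).
case/unsettledP; split=> [|w wP].
  by apply/negP => eP; have := vN _ eP; rewrite ev.
exact: elm_nonadj (IH _ wP) (elm_idem EL v).
Qed.

Lemma unsettled_elm j v : elm v = v -> v \notin pivots j -> v \in unsettled j.
Proof.
by move=> vv vP; apply/unsettledP; split=> // w /pivots_elm ww; apply: elm_nonadj.
Qed.

(* x can leave its PIVOT cluster only if the pivot of that cluster, or an
   earlier neighbour of x, is still unsettled. *)
Definition late x := (elm x \in unsettled r) ||
  [exists w in unsettled r, e x w && (rank p w < rank p (elm x))].

Lemma rpivot_leaderP x :
  leader x = elm x \/ leader x = x /\ late x.
Proof.
rewrite /rpivot_leader /late; have UP := @unsettledP r; have PE := @pivots_elm r.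
have UE := @unsettled_elm r.
case: (rpivot_state e r p) UP PE UE => P U /= UP PE UE.
case: (boolP (x \in P)) => xP; first by left; rewrite PE.
have elmP : elm x \notin U -> elm x \in P :&: nbhd e x.
  move=> eU; have eP : elm x \in P.
    by apply: contraNT eU => /UE-> //; apply: (elm_idem EL).
  rewrite inE eP inE e_sym; case: (elm_adj EL x) => // xx.
  by rewrite -xx eP in xP.
case: ifP => [/exists_inP[w /setIP[wU]]|/negbT noW].
  rewrite inE => xw /forall_inP wmin; right; split=> //.
  case: (boolP (elm x \in U)) => //= /elmP eP.
  by apply/exists_inP; exists w => //; rewrite xw wmin.
case low: lowest => [v|]; last first.
  right; split=> //; apply: contraT; rewrite negb_or => /andP[/elmP].
  by rewrite (lowest_None low) inE.
have [/setIP[vP]] := lowest_Some low; rewrite inE => xv vmin; left.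
apply/esym/elm_unique; [exact: PE|by right; rewrite e_sym|].
case: (boolP (elm x \in U)) => [eU|/elmP]; last exact: vmin.
(* An unsettled [elm x] below every marked pivot next to x would have made x a singleton. *)
rewrite leqNgt; apply: contra noW => lt.
have xe : e x (elm x).
  rewrite e_sym; case: (elm_adj EL x) => // xx.
  have /UP[_ N] := eU; have := elm_nonadj (PE _ vP) xx; by rewrite e_sym xv.
apply/exists_inP; exists (elm x); first by rewrite !inE eU.
apply/forall_inP => w wN; exact: leq_trans lt (vmin w wN).
Qed.

Definition split_edge x y := [&& e x y, elm x == elm y & leader x != leader y].

(** Clusters of r-PIVOT lie inside those of PIVOT, so no non-edge becomes newly joined and only
    edges inside PIVOT clusters can be newly cut. *)
Lemma cost_rpivot : cost e (rpivot e r p) <=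
  cost e (pivot e p) + #|[set [set x; y] | x in V, y in V & split_edge x y]|.
Proof.
rewrite /cost -addnA [X in _ <= _ + X]addnC addnA; apply: leq_add.
  apply: leq_trans (leq_card_setU _ _).1; apply/subset_leq_card/subsetP.
  move=> _ /imset2P[x y _ + ->]; rewrite inE => /andP[_ /andP[xy]].
  rewrite eq_pblock_rpivot in_setU => ne.
  case: (boolP (elm x == elm y)) => eE; apply/orP; [right|left];
    apply/imset2P; exists x y => //; rewrite inE /=.
    by rewrite /split_edge xy eE.
  by rewrite xy eq_pblock_pivot.
apply/subset_leq_card/subsetP => _ /imset2P[x y _ + ->].
rewrite inE => /andP[_ /and3P[nxy nexy]].
rewrite eq_pblock_rpivot => eqL; apply/imset2P; exists x y => //.
rewrite inE /= nxy nexy eq_pblock_pivot /=.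
case: (rpivot_leaderP x) (rpivot_leaderP y) => [Lx|[Lx _]] [Ly|[Ly _]];
  move: eqL; rewrite Lx Ly // => /eqP.
- by move=> <-; rewrite (elm_idem EL).
- by move=> ->; rewrite (elm_idem EL).
- by move=> xy; rewrite xy.
Qed.

End Clusters.

(** * Mistaken pairs and the reward forced by split edges *)

Lemma card_unordered_pairs (V : finType) (Q : rel V) :
  symmetric Q -> irreflexive Q ->
  #|[set z : V * V | Q z.1 z.2]| =
  2 * #|[set [set x; y] | x in V, y in V & Q x y]|.
Proof.
move=> Qsym Qirr; pose f (z : V * V) := [set z.1; z.2].
set D := [set [set x; y] | x in V, y in V & Q x y].
have fD z : z \in [set z : V * V | Q z.1 z.2] -> f z \in D.
  by rewrite inE => Qz; apply/imset2P; exists z.1 z.2; rewrite ?inE.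
rewrite -sum1_card (partition_big f (mem D)) //= mulnC -sum_nat_const.
apply: eq_bigr => _ /imset2P[a b _ + ->]; rewrite inE => /andP[_ Qab].
have nab : a != b by apply: contraTneq Qab => ->; rewrite Qirr.
(* The number 2 is rewritten as the size of {(a, b), (b, a)}, the fibre over {a, b}. *)
rewrite sum1_card -[2]/(true.+1) -(_ : (a, b) != (b, a) = true) -?cards2; last first.
  by rewrite xpair_eqE negb_and nab.
apply: eq_card => -[x y]; rewrite !inE !xpair_eqE.
apply/andP/orP => /= [[Qxy /eqP E]|[]/andP[/eqP-> /eqP->]]; last 2 first.
- by rewrite inE Qab /f eqxx.
- by rewrite inE /= Qsym Qab /f setUC eqxx.
have : x \in [set a; b] by rewrite -E /f !inE eqxx.
have : y \in [set a; b] by rewrite -E /f !inE eqxx orbT.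
move: Qxy; rewrite inE => /= /[swap]/set2P[]-> /[swap]/set2P[]->; rewrite ?Qirr // !eqxx.
  by right.
by left.
Qed.

Section Lower.

Variables (R : realFieldType) (V : finType) (e : rel V).
Hypotheses (e_sym : symmetric e) (e_irr : irreflexive e).
Variable K : V -> {set V}.

Definition mistake x y := (x != y) && (if e x y then K x != K y else K x == K y).

Definition mistakes := [set z : V * V | mistake z.1 z.2].

Lemma mistakes_neq : {in mistakes, forall z, z.1 != z.2}.
Proof. by move=> z; rewrite inE => /andP[]. Qed.

Variables (p : {perm V}) (r : nat).

Local Notation elm := (elm R e mistakes p).
Let EL := elm_eliminator R e_sym e_irr mistakes p.
Local Notation gainM := (gain R e mistakes).
Local Notation final := (final_weight R e mistakes p).
Local Notation state_at := (state_at R e mistakes p).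
Local Notation unsettled j := (rpivot_state e j p).2.

Lemma gain_ge1 a b v k y : mistake a b -> mark R e a b v k y = 1%R ->
  (1 <= gainM v k y)%R.
Proof.
move=> ab m1; rewrite /gain (bigD1 (a, b)) ?inE //= m1 lerDl.
by apply: sumr_ge0 => z _; apply: mark_ge0.
Qed.

Lemma final_call x y : e x y ->
  rank p x < rank p y -> rank p x <= rank p (elm y) ->
  (final x + gainM x (killer (state_at (rank p x)) x) y <= final y)%R.
Proof. by move=> xy lt le; apply: weight_call => //; apply/ltnW/rank_lt. Qed.

(* {w, x, elm x} induces a path with centre x, so every clustering errs on one
   of its three pairs. *)
Lemma bad_triangle_gain w x : elm w = w -> e w x -> rank p x < rank p w ->
  elm x != x -> elm x != w ->
  (1 <= gainM x (killer (state_at (rank p x)) x) w +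
     gainM (elm x) (killer (state_at (rank p (elm x))) (elm x)) x)%R.
Proof.
move=> ww wx lt nx nw.
have [ex ltx] := (elm_edge EL nx, elm_rank_lt EL nx).
have kx : killer (state_at (rank p x)) x = Some (elm x).
  by rewrite killer_elm ?(ltnW (rank_lt p x)) // ltx nx.
have nwe : ~~ e w (elm x).
  by apply: (elm_nonadj e_sym e_irr EL) => //; apply: (elm_idem EL).
set g1 := gainM x _ w; set g2 := gainM (elm x) _ x.
have [g1_ge0 g2_ge0] : (0 <= g1)%R /\ (0 <= g2)%R by split; apply: gain_ge0.
have neq u v : e u v -> u != v by apply: contraTneq => ->; rewrite e_irr.
case: (boolP (mistake w x)) => [m|].
  apply: le_trans (_ : g1 <= _)%R; last by rewrite lerDl.
  by apply: (gain_ge1 m); rewrite /mark wx !eqxx.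
rewrite /mistake wx neq //= negbK => /eqP Kwx.
case: (boolP (mistake x (elm x))) => [m|].
  apply: le_trans (_ : g2 <= _)%R; last by rewrite lerDr.
  by apply: (gain_ge1 m); rewrite /mark e_sym ex !eqxx.
rewrite /mistake e_sym ex eq_sym neq //= negbK => /eqP Kxe.
have m : mistake w (elm x) by rewrite /mistake (negbTE nwe) eq_sym nw Kwx Kxe eqxx.
apply: le_trans (_ : g1 <= _)%R; last by rewrite lerDl.
by apply: (gain_ge1 m); rewrite /mark (negbTE nwe) kx !eqxx.
Qed.

Lemma unsettled_elm_unsettled j x : x \in unsettled j -> elm x \in unsettled j.
Proof.
move=> xU; apply: (unsettled_elm e_sym e_irr EL); first exact: (elm_idem EL).
apply/negP => eP; have [xP N] := elimT (unsettledP e p j x) xU.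
case: (elm_adj EL x) => ex; first by rewrite ex (negbTE xP) in eP.
by have := N _ eP; rewrite ex.
Qed.

(** One round of delay is worth one bad triangle: w queries a neighbour x, which queries the pivot
    [elm x], unsettled one round earlier. The two queries together gain at least 1. *)
Lemma final_ge_rounds j w : elm w = w -> w \in unsettled j -> (j%:R <= final w)%R.
Proof.
elim: j w => [|j IH] w ww wU; first by apply: weight_ge0; apply/ltnW/rank_lt.
have wUj : w \in unsettled j.
  move: wU; rewrite /rpivot_state iterS -/(rpivot_state e j p) /= inE.
  by case/andP.
have [x xU /andP[wx le]] : exists2 x, x \in unsettled j &
    e w x && (rank p x <= rank p w).
  have [+ _] := elimT (unsettledP e p j.+1 w) wU.
  rewrite pivotsS negb_or wUj /= => /andP[_].
  rewrite negb_forall_in => /exists_inP[x /setIP[xU]].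
  by rewrite inE -leqNgt => wx le; exists x; rewrite ?wx.
have lt : rank p x < rank p w.
  rewrite ltn_neqAle le andbT; apply/eqP => /rank_inj xw.
  by rewrite xw e_irr in wx.
have nx : elm x != x.
  apply/eqP => xx; have := elm_min EL xx (or_intror _ : x = w \/ e x w).
  by rewrite e_sym wx ww leqNgt lt => /(_ isT).
have [ex ltx] := (elm_edge EL nx, elm_rank_lt EL nx).
have nw : elm x != w.
  by apply: contraTneq ltx => ->; rewrite -leqNgt ltnW.
have := bad_triangle_gain ww wx lt nx nw.
have := IH (elm x) (elm_idem EL x) (unsettled_elm_unsettled xU).
have := final_call ex ltx (leqnn _).
have : e x w by rewrite e_sym.
move=> /final_call/(_ lt); rewrite ww => /(_ (ltnW lt)).
rewrite -natr1; lra.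
Qed.

Local Notation late := (late e p elm r).
Local Notation leader := (rpivot_leader e r p).

(** In the second case the early neighbour w cannot be a pivot, so [elm w] is an unsettled pivot of
    weight at least r. This weight reaches w and then x before [elm x] arrives. *)
Lemma late_weight x : late x ->
  (r%:R <= final (elm x))%R \/ (r%:R <= weight (state_at (rank p (elm x))) x)%R.
Proof.
case/orP=> [eU|/exists_inP[w wU /andP[xw lt]]].
  by left; apply: final_ge_rounds => //; apply: (elm_idem EL).
right; have wx : e w x by rewrite e_sym.
have nw : elm w != w.
  by apply/eqP => ww; have := elm_min EL ww (or_intror wx); rewrite leqNgt lt.
have [ew ltw] := (elm_edge EL nw, elm_rank_lt EL nw).
have := final_ge_rounds (elm_idem EL w) (unsettled_elm_unsettled wU).
have := final_call ew ltw (leqnn _).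
have := weight_call e_sym wx lt (ltnW (rank_lt p _)) (ltnW lt).
have := gain_ge0 R e mistakes w (killer (state_at (rank p w)) w) x.
have := gain_ge0 R e mistakes (elm w) (killer (state_at (rank p (elm w))) (elm w)) w.
lra.
Qed.

Lemma split_late x y : split_edge e p elm r x y -> late x || late y.
Proof.
case/and3P=> _ /eqP exy; case: (rpivot_leaderP e_sym e_irr EL r x) => [->|[_ ->//]].
case: (rpivot_leaderP e_sym e_irr EL r y) => [->|[_ ->]]; last by rewrite orbT.
by rewrite exy eqxx.
Qed.

Lemma final_elm x : (final (elm x) <= final x)%R.
Proof.
have [->//|nx] := eqVneq (elm x) x.
have [ex ltx] := (elm_edge EL nx, elm_rank_lt EL nx).
have := final_call ex ltx (leqnn _).
have := gain_ge0 R e mistakes (elm x) (killer (state_at (rank p (elm x))) (elm x)) x.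
lra.
Qed.

Lemma late_final x : late x -> (r%:R <= final x)%R.
Proof.
case/late_weight => /le_trans; apply; first exact: final_elm.
by apply: weight_mono; [apply: (elm_rank EL) | apply/ltnW/rank_lt].
Qed.

Local Notation split := (split_edge e p elm r).
Local Notation total := (total_reward e mistakes (start R V) (arrivals p)).

(** An edge at the pivot is paid by the arrival reward of its other end; any other split edge is
    paid by the triangle that it forms with the pivot. *)
Lemma split_weight x y : (r%:R * (split x y)%:R <=
  (y == elm x)%:R * final x + (x == elm y)%:R * final y +
  ([&& elm x == elm y, x != elm x & y != elm y] && e x y)%:R *
    (final (elm x) + weight (state_at (rank p (elm x))) x
     + weight (state_at (rank p (elm x))) y))%R.
Proof.
have wge0 k z : k <= #|V| -> (0 <= weight (state_at k) z)%R.
  by move=> kV; apply: weight_ge0.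
have fge0 z : (0 <= final z)%R by apply/wge0/ltnW/rank_lt.
have rV z := ltnW (rank_lt p z).
case: (boolP (split x y)) => sxy; last first.
  by rewrite mulr0 !addr_ge0 // mulr_ge0 // !addr_ge0 // wge0.
have lxy := split_late sxy; case/and3P: sxy => exy /eqP Exy _.
have xw z : (0 <= weight (state_at (rank p (elm x))) z)%R by apply/wge0/rV.
rewrite mulr1; set T := (_%:R * (final (elm x) + _ + _))%R.
have T0 : (0 <= T)%R by rewrite mulr_ge0 // !addr_ge0.
have [yx|nyx] := eqVneq y (elm x).
  apply: le_trans (_ : final x <= _)%R; last first.
    by rewrite mul1r -addrA lerDl addr_ge0 // mulr_ge0.
  case/orP: lxy => [/late_final//|]; rewrite yx => /late_final/le_trans; apply.
  exact: final_elm.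
have [xy|nxy] := eqVneq x (elm y).
  apply: le_trans (_ : final y <= _)%R; last by rewrite mul0r add0r mul1r lerDl.
  case/orP: lxy => [|/late_final//]; rewrite xy => /late_final/le_trans; apply.
  exact: final_elm.
rewrite !mul0r !add0r /T Exy eqxx nxy -Exy nyx exy mul1r.
have := fge0 (elm x); have := xw x; have := xw y.
case/orP: lxy => /late_weight[]; rewrite -?Exy; lra.
Qed.

(** Summing over ordered pairs bounds twice the left side by twice the final weights plus T, while 6
    * [total] is six times the final weights plus T. *)
Lemma split_total :
  (r%:R * #|[set [set x; y] | x in V, y in V & split x y]|%:R <= 3 * total)%R.
Proof.
have ssym : symmetric split.
  by move=> x y; rewrite /split_edge e_sym (eq_sym (elm x)) (eq_sym (leader x)).
have sirr : irreflexive split by move=> x; rewrite /split_edge e_irr.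
have cardE2 : (2 * #|[set [set x; y] | x in V, y in V & split x y]|%:R =
    \sum_x \sum_y (split x y)%:R :> R)%R.
  rewrite -natrM -card_unordered_pairs // -sum1_card natr_sum pair_bigA /=.
  rewrite [RHS](bigID (fun z => split z.1 z.2)) /= [X in (_ + X)%R]big1 => [|z /negbTE->//].
  by rewrite addr0; apply: eq_big => z; rewrite inE // => ->.
have fge0 z : (0 <= final z)%R by apply/weight_ge0/ltnW/rank_lt.
have := total_lower_bound R e_sym e_irr mistakes p.
set T := (\sum_x \sum_y _)%R => totE.
have : (\sum_x \sum_y r%:R * (split x y)%:R <= (\sum_x final x + \sum_x final x) + T)%R.
  have -> : (\sum_x final x + \sum_x final x =
     \sum_x \sum_y ((y == elm x)%:R * final x + (x == elm y)%:R * final y))%R.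
    under [RHS]eq_bigr => x _ do rewrite big_split.
    rewrite big_split /= [X in (_ = _ + X)%R]exchange_big /=.
    congr (_ + _)%R; apply: eq_bigr => x _; rewrite (bigD1 (elm x)) //= eqxx mul1r.
      by rewrite big1 ?addr0 // => y /negbTE->; rewrite mul0r.
    by rewrite big1 ?addr0 // => y /negbTE->; rewrite mul0r.
  rewrite -big_split; apply: ler_sum => x _; rewrite -big_split.
  by apply: ler_sum => y _; apply: split_weight.
under eq_bigr => x _ do rewrite -big_distrr.
rewrite -big_distrr /= -cardE2 totE.
have : (0 <= \sum_x final x)%R by apply: sumr_ge0.
lra.
Qed.

End Lower.

(** * Comparison with an optimal clustering *)

Lemma card_mistakes (V : finType) (e : rel V) (P : {set {set V}}) :
  symmetric e -> irreflexive e -> #|mistakes e (pblock P)| <= 2 * cost e P.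
Proof.
move=> e_sym e_irr; rewrite /cost mulnDr -!card_unordered_pairs //.
- apply: leq_trans (leq_card_setU _ _).1; apply/subset_leq_card/subsetP => z.
  by rewrite !inE /mistake => /andP[->]; case: (e z.1 z.2) => /= ->; rewrite ?orbT.
- by move=> x y; rewrite eq_sym (e_sym x) [X in [&& _, _ & X]]eq_sym.
- by move=> x; rewrite eqxx.
- by move=> x y; rewrite eq_sym e_sym.
- by move=> x; rewrite e_irr.
Qed.

Local Open Scope ring_scope.

Theorem theorem1 (R : realFieldType) (V : finType) (e : rel V)
    (e_sym : symmetric e) (e_irr : irreflexive e) (r : nat) (r_ge1 : (1 <= r)%N) :
  expect_perm R (fun p : {perm V} => cost e (rpivot e r p)) <=
  expect_perm R (fun p : {perm V} => cost e (pivot e p)) +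
  8 / (2 * r%:R - 1) * (OPT e)%:R.
Proof.
have [P _ costP] := OPT_attained e.
pose D := mistakes e (pblock P).
pose N : R := #|{: {perm V}}|%:R.
have N_gt0 : 0 < N by rewrite ltr0n; apply/card_gt0P; exists 1%g.
pose tot p := total_reward e D (start R V) (arrivals p).
pose extra p := #|[set [set x; y] | x in V, y in V &
  split_edge e p (elm R e D p) r x y]|.
have total_le : \sum_p tot p <= N * (OPT e)%:R.
  apply: le_trans (sum_total_arrivals R e_sym e_irr _) _.
    exact: mistakes_neq.
  rewrite ler_pM2l // ler_pdivrMr // -natrM ler_nat -costP mulnC.
  exact: card_mistakes.
have extra_le : r%:R * \sum_p (extra p)%:R <= 3 * (N * (OPT e)%:R).
  apply: le_trans (_ : 3 * \sum_p tot p <= _); last by rewrite ler_pM2l.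
  rewrite !mulr_sumr; apply: ler_sum => p _; exact: split_total.
have cost_le : \sum_(p : {perm V}) (cost e (rpivot e r p))%:R <=
    \sum_(p : {perm V}) (cost e (pivot e p))%:R + \sum_p (extra p)%:R :> R.
  rewrite -big_split; apply: ler_sum => p _ /=; rewrite -natrD ler_nat.
  by apply: cost_rpivot => //; apply: elm_eliminator.
rewrite /expect_perm -/N ler_pdivrMr // mulrDl divfK ?gt_eqF //.
apply: le_trans cost_le _; rewrite lerD2l.
have r1 : 1 <= r%:R :> R by rewrite ler1n.
have r0 : 0 < r%:R :> R by rewrite ltr0n.
have d0 : 0 < 2 * r%:R - 1 :> R by lra.
have O0 : 0 <= N * (OPT e)%:R by rewrite mulr_ge0 // ltW.
apply: le_trans (_ : 3 / r%:R * (N * (OPT e)%:R) <= _).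
  by rewrite mulrAC ler_pdivlMr // mulrC.
rewrite -[leRHS]mulrA [_%:R * N]mulrC ler_wpM2r //.
(* This is 3 * (2r - 1) <= 8r. *)
rewrite ler_pdivrMr // mulrAC ler_pdivlMr //; lra.
Qed.
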